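(* Let $n \ge 1$ and $0 \le r \le n$ be integers. For any probabilistic $0$-bit entanglement distillation protocol $\mathcal{P}$ that takes $n$ qubit pairs as input and outputs one qubit pair, the fidelity of $\mathcal{P}$ with respect to the measure-$r$ error model $\mathcal{M}^{\mathsf{m}}_{n,r}$ satisfies $$F_{\mathcal{M}^{\mathsf{m}}_{n,r}}(\mathcal{P}) \;\le\; 1-\frac{r}{2n}.$$
   Context: Notation. Alice and Bob each hold $n$ qubits; the $j$-th qubit of Alice and the $j$-th qubit of Bob form the $j$-th qubit pair ($j=0,\dots,n-1$). Superscripts $A,B$ indicate the party. $\Phi^+=\frac{1}{\sqrt2}(|0\rangle^A|0\rangle^B+|1\rangle^A|1\rangle^B)$. Measure-$r$ error model. A binary indicator vector is $\mathbf{v}\in\{0,1,*\}^n$; its degree $\deg(\mathbf v)$ is the number of entries that are not $*$. It determines the bipartite pure state $|\phi_{\mathbf v}\rangle=\bigotimes_{j=0}^{n-1}|\phi_j\rangle$, where $|\phi_j\rangle=|0\rangle^A|0\rangle^B$ if $\mathbf v[j]=0$, $|\phi_j\rangle=|1\rangle^A|1\rangle^B$ if $\mathbf v[j]=1$, and $|\phi_j\rangle=\Phi^+$ if $\mathbf v[j]=*$. The measure-$r$ error model is the set of states $$\mathcal{M}^{\mathsf m}_{n,r}=\{|\phi_{\mathbf v}\rangle : \mathbf v\in\{0,1,*\}^n,\ \deg(\mathbf v)=r\}.$$ Protocols. A deterministic $0$-bit protocol involves no communication: each party adjoins private ancillary qubits initialized to $|0\rangle$, performs a local quantum operation on his or her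 own qubits (independently of the other party), outputs one qubit and discards the rest; equivalently, Alice and Bob apply local quantum channels $\mathcal{E}_A$ and $\mathcal{E}_B$, each from $n$ qubits to one qubit. In a probabilistic $0$-bit protocol Alice and Bob additionally share a classical random string, independent of the input state, on which their local operations may depend; the output state $\mathcal{P}(\rho)$ is the average over the random string of $(\mathcal{E}_A\otimes\mathcal{E}_B)(\rho)$. No initial entanglement other than the input and no quantum channel between the parties is allowed. Fidelity. For a state $\sigma$ of one qubit pair, $F(\sigma)=\langle\Phi^+|\sigma|\Phi^+\rangle$. For an error model (set of states) $\mathcal M$, $F_{\mathcal M}(\mathcal P)=\min_{\rho\in\mathcal M}F(\mathcal P(\rho))$ (pure states are identified with their density matrices). *)

(* Defs.v *)
From HB Require Import structures.
From mathcomp Require Import all_boot all_order all_algebra.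
From mathcomp Require Import classical_sets reals.
From mathcomp Require Import complex mxtens.

Set Implicit Arguments.
Unset Strict Implicit.
Unset Printing Implicit Defensive.

Import Order.TTheory GRing.Theory Num.Theory.

Local Open Scope ring_scope.
Local Open Scope complex_scope.
Local Open Scope classical_set_scope.

Section Defs.
Variable R : realType.
Local Notation C := R[i].

Definition adjmx m n (A : 'M[C]_(m, n)) : 'M[C]_(n, m) := map_mx Num.conj A^T.

(* In the order of C, [0 <= z] says that z is real and nonnegative, so this
   includes hermitianness. *)
Definition psdmx m (A : 'M[C]_m) : Prop :=
  forall x : 'cV[C]_m, 0 <= (adjmx x *m A *m x) ord0 ord0.

Definition density m (psi : 'cV[C]_m) : 'M[C]_m := psi *m adjmx psi.

(* E (x) F for linear E and F, by bilinear extension from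
   |i><j| (x) |k><l| |-> E(|i><j|) (x) F(|k><l|). *)
Definition tensmap m p m' p'
    (E : 'M[C]_m -> 'M[C]_m') (F : 'M[C]_p -> 'M[C]_p')
    (rho : 'M[C]_(m * p)) : 'M[C]_(m' * p') :=
  \sum_(i < m) \sum_(k < p) \sum_(j < m) \sum_(l < p)
    rho (mxtens_index (i, k)) (mxtens_index (j, l))
      *: (E (delta_mx i j) *t F (delta_mx k l)).

Definition completely_positive m m' (E : 'M[C]_m -> 'M[C]_m') : Prop :=
  forall (p : nat) (A : 'M[C]_(m * p)), psdmx A -> psdmx (tensmap E idfun A).

Definition trace_preserving m m' (E : 'M[C]_m -> 'M[C]_m') : Prop :=
  forall A : 'M[C]_m, \tr (E A) = \tr A.

Record channel (m m' : nat) := Channel {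
  channel_map :> {linear 'M[C]_m -> 'M[C]_m'};
  channel_cp : completely_positive channel_map;
  channel_tp : trace_preserving channel_map }.

(* The random string takes finitely many values w, with an arbitrary
   distribution. *)
Record protocol0 (n : nat) := Protocol0 {
  rand : finType;
  prob : rand -> R;
  prob_ge0 : forall w, 0 <= prob w;
  prob_sum1 : \sum_w prob w = 1;
  alice : rand -> channel (2 ^ n) 2;
  bob : rand -> channel (2 ^ n) 2 }.

Definition run n (P : protocol0 n) (rho : 'M[C]_(2 ^ n * 2 ^ n)) :
    'M[C]_(2 * 2) :=
  \sum_(w : rand P) (prob w)%:C *: tensmap (alice w) (bob w) rho.

Definition ket (a : 'I_2) : 'cV[C]_2 := delta_mx a ord0.

Definition Phi_plus : 'cV[C]_(2 * 2) :=
  ((Num.sqrt 2)^-1)%:C *: (ket 0 *t ket 0 + ket 1 *t ket 1).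

(* [None] stands for the indicator * *)
Definition pair_state (s : option 'I_2) : 'cV[C]_(2 * 2) :=
  if s is Some a then ket a *t ket a else Phi_plus.

Definition degree n (v : {ffun 'I_n -> option 'I_2}) : nat :=
  #|[pred j | v j != None]|.

(* The computational basis vector of n qubits with index a < 2 ^ n has its
   j-th qubit in the state given by the j-th binary digit of a; [inZp]
   reduces modulo 2. *)
Definition qubit n (a : 'I_(2 ^ n)) (j : 'I_n) : 'I_2 := inZp (a %/ 2 ^ j).

(* The tensor product of the n pair states, with its factors regrouped as
   (all qubits of Alice) (x) (all qubits of Bob): the amplitude at |a>|b> is
   the product of the amplitudes of the pairs at |a_j>|b_j>. *)
Definition phi_state n (v : {ffun 'I_n -> option 'I_2}) :
    'cV[C]_(2 ^ n * 2 ^ n) :=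
  \col_k let ab := mxtens_unindex k in
    \prod_(j < n)
      pair_state (v j) (mxtens_index (qubit ab.1 j, qubit ab.2 j)) ord0.

Definition measure_model (n r : nat) : set 'M[C]_(2 ^ n * 2 ^ n) :=
  [set density (phi_state v) | v in [set v | degree v = r]].

(* <Phi+|sigma|Phi+> is real when sigma is hermitian. *)
Definition fidelity (sigma : 'M[C]_(2 * 2)) : R :=
  complex.Re ((adjmx Phi_plus *m sigma *m Phi_plus) ord0 ord0).

(* The infimum of a nonempty finite set is its minimum; the measure-r model
   is finite, and nonempty for r <= n. *)
Definition model_fidelity n (M : set 'M[C]_(2 ^ n * 2 ^ n)) (P : protocol0 n)
    : R :=
  inf [set fidelity (run P rho) | rho in M].

End Defs.

Arguments measure_model : clear implicits.

(* Main.v *)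
Require Import Defs.
From mathcomp Require Import all_boot all_order all_algebra.
From mathcomp Require Import classical_sets reals.
From mathcomp Require Import complex mxtens.
From mathcomp Require Import ring.

(* Average the fidelity over the set S of measured pairs and over the outcomes.
   Averaging over the outcomes dephases the pairs in S, so that only the blocks
   |x><y| with x = y on S survive. Such a block contributes to the fidelity
   1/2 sum_ab A_ab B_ab, where A = E_A(|x><y|) and B = E_B(|x><y|), and
   |A_ab B_ab| <= (|A_ab|^2 + |B_ab|^2) / 2 makes all contributions nonnegative.
   A block with x != y survives with probability at most 1 - r/n, since S has to
   avoid a position where x and y differ. It remains to see that
   sum_xy |E(|x><y|)|^2 <= 2 * 2^n and |E(|x><x|)|^2 <= 1 for every channel E:
   in both cases a positive matrix J (the Choi matrix of E, resp. the state
   E(|x><x|)) satisfies J <= c, whence tr J^2 <= c tr J. *)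

Set Implicit Arguments.
Unset Strict Implicit.
Unset Printing Implicit Defensive.

Import Order.TTheory GRing.Theory Num.Theory.

Local Open Scope ring_scope.

(** * Positive semidefinite complex matrices *)

Section Psd.
Variable R : realType.
Local Notation C := R[i].

Lemma adjmxE m n (A : 'M[C]_(m, n)) i j : adjmx A i j = (A j i)^*.
Proof. by rewrite !mxE. Qed.

Lemma adjmxM m n p (A : 'M[C]_(m, n)) (B : 'M[C]_(n, p)) :
  adjmx (A *m B) = adjmx B *m adjmx A.
Proof. by rewrite /adjmx trmx_mul map_mxM. Qed.

Lemma adjmxK m n (A : 'M[C]_(m, n)) : adjmx (adjmx A) = A.
Proof. by apply/matrixP=> i j; rewrite !adjmxE conjCK. Qed.

Lemma adjmxD m n (A B : 'M[C]_(m, n)) : adjmx (A + B) = adjmx A + adjmx B.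
Proof. by apply/matrixP=> i j; rewrite !mxE rmorphD. Qed.

Lemma adjmx_tens m n p q (A : 'M[C]_(m, n)) (B : 'M[C]_(p, q)) :
  adjmx (A *t B) = adjmx A *t adjmx B.
Proof. by apply/matrixP=> i j; rewrite !mxE rmorphM. Qed.

Lemma adjmx1 n : adjmx (1%:M : 'M[C]_n) = 1%:M.
Proof. by rewrite /adjmx trmx1 map_mx1. Qed.

Lemma psdmxD n (A B : 'M[C]_n) : psdmx A -> psdmx B -> psdmx (A + B).
Proof.
by move=> hA hB x; rewrite mulmxDr mulmxDl mxE; apply: addr_ge0.
Qed.

Lemma psdmxZ n (a : C) (A : 'M[C]_n) : 0 <= a -> psdmx A -> psdmx (a *: A).
Proof.
by move=> ha hA x; rewrite -scalemxAr -scalemxAl mxE; apply: mulr_ge0.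
Qed.

Lemma psdmx_conj m n (P : 'M[C]_(m, n)) (A : 'M[C]_m) :
  psdmx A -> psdmx (adjmx P *m A *m P).
Proof. by move=> hA x; have := hA (P *m x); rewrite adjmxM !mulmxA. Qed.

Lemma psdmx_density n (u : 'cV[C]_n) : psdmx (density u).
Proof.
move=> x; rewrite /density mulmxA -mulmxA mxE big_ord1.
have -> : adjmx x *m u = adjmx (adjmx u *m x) by rewrite adjmxM adjmxK.
by rewrite adjmxE mulrC mul_conjC_ge0.
Qed.

Lemma form_delta n (A : 'M[C]_n) i j :
  (adjmx (delta_mx i ord0 : 'cV_n) *m A *m (delta_mx j ord0 : 'cV_n)) ord0 ord0 = A i j.
Proof.
have -> : adjmx (delta_mx i ord0 : 'cV[C]_n) = delta_mx ord0 i.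
  apply/matrixP=> k l; rewrite !mxE ord1 eqxx andbT /=.
  by case: (l == i); rewrite ?conjC1 ?conjC0.
by rewrite -rowE -colE !mxE.
Qed.

Lemma psdmx_diag_ge0 n (A : 'M[C]_n) i : psdmx A -> 0 <= A i i.
Proof. by move=> hA; rewrite -form_delta; apply: hA. Qed.

(** The form is real at [ei + a *: ej]: for a = 1 this makes A_ij + A_ji real, for a = i it makes i
    (A_ij - A_ji) real, and together they give the conjugate symmetry. *)
Lemma psdmx_hermitian n (A : 'M[C]_n) : psdmx A -> adjmx A = A.
Proof.
move=> hA; apply/matrixP=> i j; rewrite adjmxE.
set ei : 'cV[C]_n := delta_mx i ord0; set ej : 'cV[C]_n := delta_mx j ord0.
have key a : A i i + a * A i j + a^* * A j i + a^* * a * A j j \is Num.real.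
  have := ger0_real (hA (ei + a *: ej)).
  rewrite adjmxD !(mulmxDl, mulmxDr).
  have -> : adjmx (a *: ej) = a^* *: adjmx ej.
    by apply/matrixP=> k l; rewrite !mxE rmorphM.
  rewrite -!scalemxAl -!scalemxAr scalerA.
  have eqs (M N : 'M[C]_1) : (M + N) ord0 ord0 = M ord0 ord0 + N ord0 ord0.
    by rewrite mxE.
  have eqz b (M : 'M[C]_1) : (b *: M) ord0 ord0 = b * M ord0 ord0.
    by rewrite mxE.
  rewrite !eqs !eqz !form_delta.
  by congr (_ \is Num.real); ring.
have hi := geC0_conj (psdmx_diag_ge0 i hA).
have hj := geC0_conj (psdmx_diag_ge0 j hA).
have /CrealP := key 1; have /CrealP := key 'i.
rewrite !(rmorphD, rmorphM, rmorph1) /= conjCi rmorphN /= conjCi opprK hi hj.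
move=> e1 e2.
have e3 : (A j i)^* + (A i j)^* = A i j + A j i.
  apply: (addrI (A i i + A j j)).
  transitivity (A i i + 1 * (A i j)^* + 1 * (A j i)^* + 1 * 1 * A j j).
    by ring.
  by rewrite e2; ring.
have e4 : (A j i)^* - (A i j)^* = A i j - A j i.
  have i0 : 'i != 0 :> C by exact: neq0Ci.
  apply: (mulfI i0); apply: (addrI (A i i - 'i * 'i * A j j)).
  transitivity (A i i + - 'i * (A i j)^* + 'i * (A j i)^* + 'i * - 'i * A j j).
    by ring.
  by rewrite e1; ring.
have e5 : 2 * (A j i)^* = 2 * A i j.
  transitivity (((A j i)^* + (A i j)^*) + ((A j i)^* - (A i j)^*)); first by ring.
  by rewrite e3 e4; ring.
by apply: (mulfI _ e5); rewrite pnatr_eq0.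
Qed.

(* [c (c J - J^2) = (c - J) J (c - J) + J (c - J) J] is positive. *)
Lemma sum_sqr_psdmx n (c : C) (J : 'M[C]_n) : 0 < c ->
  psdmx J -> psdmx (c%:M - J) -> \sum_i \sum_j `|J i j| ^+ 2 <= c * \tr J.
Proof.
move=> c0 hJ hcJ.
have hh := psdmx_hermitian hJ; have hh' := psdmx_hermitian hcJ.
have h : psdmx (c *: (c *: J - J *m J)).
  have := psdmxD (psdmx_conj (c%:M - J) hJ) (psdmx_conj J hcJ).
  rewrite hh hh'; congr psdmx.
  rewrite !(mulmxBl, mulmxBr) !mul_scalar_mx !mul_mx_scalar.
  rewrite -!scalemxAl -?scalemxAr scalerBr scalerA.
  set a := J *m J *m J.
  by apply/matrixP=> i j; rewrite !mxE; ring.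
have : 0 <= \tr (c *: J - J *m J).
  rewrite -(pmulr_rge0 _ c0) -mxtraceZ.
  by apply: sumr_ge0 => i _; apply: psdmx_diag_ge0.
rewrite raddfB /= mxtraceZ subr_ge0; apply: le_trans.
rewrite /mxtrace le_eqVlt; apply/orP; left; apply/eqP/eq_bigr => i _.
by rewrite mxE; apply: eq_bigr => j _; rewrite normCK -adjmxE hh.
Qed.

End Psd.

(** * Choi matrices and bounds on the square sums of a channel *)

Section Choi.
Variable R : realType.
Local Notation C := R[i].

Lemma sum_mxtens_index (V : nmodType) m p (F : 'I_(m * p) -> V) :
  \sum_k F k = \sum_i \sum_j F (mxtens_index (i, j)).
Proof.
rewrite pair_big (reindex (fun ij : 'I_m * 'I_p => mxtens_index ij)) /=.
  by apply: eq_bigr => -[i j].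
exists (fun k => mxtens_unindex k) => k _.
  exact: mxtens_indexK.
exact: mxtens_unindexK.
Qed.

Definition choi m m' (E : 'M[C]_m -> 'M[C]_m') : 'M[C]_(m' * m) :=
  \sum_x \sum_y E (delta_mx x y) *t delta_mx x y.

(** Stated for an arbitrary family of blocks because [choi_le2] also needs it for conjugated
    blocks. *)
Lemma sum_tens_deltaE m m' (G : 'I_m -> 'I_m -> 'M[C]_m') a x b y :
  (\sum_i \sum_j G i j *t delta_mx i j) (mxtens_index (a, x))
    (mxtens_index (b, y)) = G x y a b.
Proof.
rewrite summxE (bigD1 x) //= summxE (bigD1 y) //= tensmxE !mxE !eqxx.
rewrite mulr1 big1 ?addr0 => [|j nj]; last first.
  by rewrite tensmxE mxE (eq_sym y) (negPf nj) andbF mulr0.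
rewrite big1 ?addr0 // => i ni; rewrite summxE big1 // => j _.
by rewrite tensmxE mxE (eq_sym x) (negPf ni) mulr0.
Qed.

Lemma choiE m m' (E : 'M[C]_m -> 'M[C]_m') a x b y :
  choi E (mxtens_index (a, x)) (mxtens_index (b, y)) = E (delta_mx x y) a b.
Proof. exact: sum_tens_deltaE. Qed.

(** The Choi matrix is E (x) id applied to the density of the unnormalized maximally entangled
    vector [omega]. *)
Lemma choi_psd m m' (E : 'M[C]_m -> 'M[C]_m') :
  completely_positive E -> psdmx (choi E).
Proof.
pose omega : 'cV[C]_(m * m) :=
  \col_k ((mxtens_unindex k).1 == (mxtens_unindex k).2)%:R.
move=> /(_ m _ (psdmx_density omega)).
congr psdmx; rewrite /tensmap /choi; apply: eq_bigr => x _.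
rewrite (bigD1 x) //= [X in _ + X]big1 ?addr0 => [|k nk]; last first.
  apply: big1 => j _; apply: big1 => l _.
  rewrite !mxE big_ord1 !mxE !mxtens_indexK /= (eq_sym x) (negPf nk).
  by rewrite mul0r scale0r.
apply: eq_bigr => y _.
rewrite (bigD1 y) //= [X in _ + X]big1 ?addr0 => [|l nl].
  by rewrite !mxE big_ord1 !mxE !mxtens_indexK /= !eqxx conjC1 mulr1 scale1r.
rewrite !mxE big_ord1 !mxE !mxtens_indexK /= (eq_sym y) (negPf nl).
by rewrite conjC0 mulr0 scale0r.
Qed.

Lemma sum_ord2 (V : nmodType) (F : 'I_2 -> V) : \sum_a F a = F 0 + F 1.
Proof. by rewrite big_ord_recl big_ord1; congr (_ + F _); apply: val_inj. Qed.

Lemma ord2P (i : 'I_2) : i = 0 \/ i = 1.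
Proof. by case: i => -[|[|//]] ?; [left | right]; apply: val_inj. Qed.

Definition paulimx_z : 'M[C]_2 := diag_mx (\row_a (-1) ^+ a).

(** Conjugation by Z flips the off-diagonal signs, so Z M Z = 2 diag(M) - M; the other two
    conjugations swap the diagonal entries and add up to tr(M) - diag(M). The right side is a Kraus
    form, hence completely positive in M. *)
Lemma pinching_id (M : 'M[C]_2) :
  (2 * \tr M)%:M - M = adjmx paulimx_z *m M *m paulimx_z +
    2 *: \sum_a adjmx (delta_mx (1 - a) a) *m M *m delta_mx (1 - a) a.
Proof.
apply/matrixP => a b; rewrite sum_ord2 !mxE.
rewrite /mxtrace !(sum_ord2, mxE).
by case: (ord2P a) => ->; case: (ord2P b) => ->;
  rewrite !eqxx /= ?expr0 ?expr1 ?mulr0n ?mulr1n ?rmorphN ?conjC0 ?conjC1 /= ?conjC1;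
  ring.
Qed.

Lemma mxtrace_delta m (x y : 'I_m) :
  \tr (delta_mx x y : 'M[C]_m) = (x == y)%:R.
Proof.
rewrite /mxtrace (bigD1 x) //= mxE eqxx big1 ?addr0 // => i ni.
by rewrite mxE (negPf ni).
Qed.

(* E(|x><y|) replaced by 2 tr(E(|x><y|)) - E(|x><y|) in the Choi matrix gives
   2 - J, by trace preservation; [pinching_id] then displays it as positive. *)
Lemma choi_le2 m (E : {linear 'M[C]_m -> 'M[C]_2}) :
  completely_positive E -> trace_preserving E -> psdmx (2%:M - choi E).
Proof.
move=> hcp htp; have hJ := choi_psd hcp.
suff -> : 2%:M - choi E =
    adjmx (paulimx_z *t 1%:M) *m choi E *m (paulimx_z *t 1%:M) +
    2 *: \sum_(a < 2) adjmx (delta_mx (1 - a) a *t 1%:M) *m choi E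
      *m (delta_mx (1 - a) a *t 1%:M).
  apply: psdmxD (psdmx_conj _ hJ) (psdmxZ _ _); first by rewrite ler0n.
  by rewrite sum_ord2; apply: psdmxD; apply: psdmx_conj.
have conjE (A : 'M[C]_2) : adjmx (A *t 1%:M) *m choi E *m (A *t 1%:M) =
    \sum_x \sum_y (adjmx A *m E (delta_mx x y) *m A) *t delta_mx x y.
  rewrite /choi mulmx_sumr mulmx_suml; apply: eq_bigr => x _.
  rewrite mulmx_sumr mulmx_suml; apply: eq_bigr => y _.
  by rewrite adjmx_tens !tensmx_mul adjmx1 mul1mx mulmx1.
rewrite sum_ord2 !conjE.
apply/matrixP => i j.
case: (mxtens_indexP i) => a x; case: (mxtens_indexP j) => b y.
(* Entrywise rules that stop at the outer sums; [mxE] would also unfold the matrix products. *)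
have addE n (X Y Z : 'M[C]_n) k l :
    (X + 2 *: (Y + Z)) k l = X k l + 2 * (Y k l + Z k l) by rewrite !mxE.
have subE n (c : C) (X : 'M[C]_n) k l :
    (c%:M - X) k l = c *+ (k == l) - X k l by rewrite !mxE.
have /matrixP/(_ a b) := pinching_id (E (delta_mx x y)).
rewrite addE !sum_tens_deltaE sum_ord2 addE => <-.
rewrite !subE choiE (inj_eq (can_inj (@mxtens_indexK _ _))) xpair_eqE htp.
by rewrite mxtrace_delta; case: (a == b); case: (x == y); rewrite ?mulr1 ?mulr0.
Qed.

(** This is [sum_sqr_psdmx] with c = 2 for the Choi matrix, whose entries are those of the blocks
    and whose trace is m by trace preservation. *)
Lemma sum_sqr_channel m (E : channel R m 2) :
  \sum_x \sum_y \sum_a \sum_b `|E (delta_mx x y) a b| ^+ 2 <= 2 * m%:R :> C.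
Proof.
have hcp := @channel_cp _ _ _ E; have htp := @channel_tp _ _ _ E.
have := sum_sqr_psdmx (ltr0n _ 2) (choi_psd hcp) (choi_le2 hcp htp).
have -> : \tr (choi E) = m%:R.
  rewrite /mxtrace sum_mxtens_index exchange_big /=.
  rewrite -[m in RHS]card_ord -sum1_card natr_sum; apply: eq_bigr => x _.
  transitivity (\tr (E (delta_mx x x))); last first.
    by rewrite htp mxtrace_delta eqxx.
  by apply: eq_bigr => a _; rewrite choiE.
apply: le_trans; rewrite le_eqVlt; apply/orP; left; apply/eqP.
rewrite [RHS]sum_mxtens_index [RHS]exchange_big; apply: eq_bigr => x _.
transitivity (\sum_a \sum_b \sum_y `|E (delta_mx x y) a b| ^+ 2).
  rewrite exchange_big; apply: eq_bigr => a _; exact: exchange_big.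
apply: eq_bigr => a _; rewrite sum_mxtens_index; apply: eq_bigr => b _.
by apply: eq_bigr => y _; rewrite choiE.
Qed.

Lemma sum_sqr_channel_diag m (E : channel R m 2) x :
  \sum_a \sum_b `|E (delta_mx x x) a b| ^+ 2 <= 1 :> C.
Proof.
have hcp := @channel_cp _ _ _ E; have htp := @channel_tp _ _ _ E.
set s := E (delta_mx x x).
have tr1 : \tr s = 1 by rewrite /s htp mxtrace_delta eqxx.
have hs : psdmx s.
  (* s is the (x, x) block of the Choi matrix, so its form at u is the Choi form at u (x) |x>. *)
  move=> u; have := choi_psd hcp (u *t (delta_mx x ord0 : 'cV[C]_m)).
  congr (0 <= _); rewrite !mxE sum_mxtens_index; apply: eq_bigr => b _.
  rewrite (bigD1 x) //= [X in _ + X]big1 ?addr0 => [|y ny]; last first.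
    by rewrite !mxE mxtens_indexK /= (negPf ny) !mulr0.
  rewrite !mxE sum_mxtens_index mxtens_indexK /= !eqxx.
  rewrite !mulr_suml; apply: eq_bigr => a _.
  rewrite (bigD1 x) //= [X in _ + X]big1 ?addr0 => [|y ny]; last first.
    by rewrite !mxE mxtens_indexK /= (negPf ny) !mulr0 conjC0 !mul0r.
  rewrite !mxE mxtens_indexK /= eqxx choiE.
  by rewrite !(ord1 (Ordinal _)) eqxx !mulr1.
have := sum_sqr_psdmx ltr01 hs _; rewrite tr1 mulr1; apply => u.
(* Spin flip: since s is 2 x 2 of trace 1, the form of 1 - s at u is the form of s at v. *)
pose v : 'cV[C]_2 := \col_a (if a == 0 then (u 1 ord0)^* else - (u 0 ord0)^*).
have := hs v; congr (0 <= _).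
rewrite !mxE !(sum_ord2, mxE) /= rmorphN /= !conjCK.
have -> : s 0 0 = 1 - s 1 1 by rewrite -tr1 /mxtrace sum_ord2 addrK.
by ring.
Qed.

End Choi.

(** * Fidelity and the states of the error model in coordinates *)

Section Fidelity.
Variable R : realType.
Local Notation C := R[i].

Definition sqrtV2 : C := real_complex R (Num.sqrt 2)^-1.
Local Notation h := sqrtV2.

Lemma sqrtV2_real : h^* = h.
Proof. by apply/CrealP/complex_realP; exists (Num.sqrt 2)^-1. Qed.

Lemma sqrtV2_sqr : h * h = 2^-1.
Proof.
rewrite /sqrtV2 -rmorphM /= -invfM -expr2 sqr_sqrtr ?ler0n // fmorphV /=.
by rewrite rmorph_nat.
Qed.

Lemma ket_tens a c d : (ket R a *t ket R a) (mxtens_index (c, d)) ord0 =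
  ((c == a) && (d == a))%:R.
Proof.
rewrite !mxE mxtens_indexK /= !(ord1 (Ordinal _)) eqxx !andbT.
by rewrite -natrM mulnb.
Qed.

Lemma Phi_plusE a b : Phi_plus R (mxtens_index (a, b)) ord0 = h * (a == b)%:R.
Proof.
have -> : Phi_plus R = h *: (ket R 0 *t ket R 0 + ket R 1 *t ket R 1) by [].
rewrite mxE [X in _ * X]mxE !ket_tens.
by case: (ord2P a) => ->; case: (ord2P b) => ->;
  rewrite !eqxx /= ?addr0 ?add0r.
Qed.

(** Phi+ is supported on the vectors |a>|a> with equal amplitudes, so only the entries of M (x) N
    between such vectors survive. Arbitrary M and N are allowed, as the images of off-diagonal
    blocks are not states. *)
Lemma fidelity_tens (M N : 'M[C]_2) :
  (adjmx (Phi_plus R) *m (M *t N) *m Phi_plus R) ord0 ord0 =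
  2^-1 * \sum_a \sum_b M a b * N a b.
Proof.
have diag (G : 'I_2 -> 'I_2 -> C) :
    \sum_a \sum_b G a b * (h * (a == b)%:R) = h * \sum_a G a a.
  rewrite mulr_sumr; apply: eq_bigr => a _; rewrite (bigD1 a) //= eqxx mulr1.
  rewrite big1 ?addr0 => [|b nb]; first exact: mulrC.
  by rewrite eq_sym (negPf nb) !mulr0.
rewrite mxE sum_mxtens_index.
under eq_bigr do under eq_bigr do rewrite Phi_plusE.
rewrite diag -sqrtV2_sqr -mulrA; congr (_ * _).
rewrite exchange_big mulr_sumr /=; apply: eq_bigr => b _.
rewrite mxE sum_mxtens_index -(diag (fun a c => M a b * N c b)).
apply: eq_bigr => a _; apply: eq_bigr => c _.
by rewrite adjmxE Phi_plusE tensmxE rmorphM /= conjC_nat sqrtV2_real mulrC.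
Qed.

(** The amplitude at |a>|a>; a pair state vanishes at |a>|b> for a != b, so one bit suffices. *)
Definition amp (s : option 'I_2) (a : 'I_2) : C :=
  if s is Some b then (a == b)%:R else h.

Lemma amp_conj s a : (amp s a)^* = amp s a.
Proof. by case: s => [b|] /=; [rewrite conjC_nat | exact: sqrtV2_real]. Qed.

Lemma amp_ge0 s a : 0 <= amp s a.
Proof.
case: s => [b|] /=; first by rewrite ler0n.
by rewrite /sqrtV2 ler0c invr_ge0 sqrtr_ge0.
Qed.

Lemma pair_stateE s a b :
  pair_state R s (mxtens_index (a, b)) ord0 = (a == b)%:R * amp s a.
Proof.
case: s => [c|] /=; last by rewrite Phi_plusE mulrC.
rewrite ket_tens -natrM mulnb.
by case: (eqVneq a c) => [->|]; rewrite ?andbF //= andbT eq_sym.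
Qed.

(** Induction on n, splitting off the lowest binary digit; halving shifts the other digits down by
    one. *)
Lemma qubit_inj n (x y : 'I_(2 ^ n)) : (forall j, qubit x j = qubit y j) -> x = y.
Proof.
move=> eq_xy; apply: val_inj.
have {eq_xy} : forall j, (j < n)%N -> ((x %/ 2 ^ j) %% 2 = (y %/ 2 ^ j) %% 2)%N.
  by move=> j jn; have := congr1 val (eq_xy (Ordinal jn)).
case: x y => [a lta] [b ltb] /=.
elim: n a b lta ltb => [|n IHn] a b; first by rewrite expn0 !ltnS !leqn0 => /eqP-> /eqP->.
rewrite expnSr => ha hb hab /=.
rewrite (divn_eq a 2) (divn_eq b 2); congr (_ * _ + _)%N.
  apply: IHn; rewrite ?ltn_divLR // => j jn.
  by rewrite -!divnMA -expnS; apply: hab.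
by have := hab 0%N isT; rewrite expn0 !divn1.
Qed.

Lemma qubit_neq n (x y : 'I_(2 ^ n)) :
  x != y -> exists j, qubit x j != qubit y j.
Proof.
move=> nxy; apply/existsP; apply: contraNT nxy => /existsPn nex.
by apply/eqP/qubit_inj => j; apply/eqP; rewrite -[_ == _]negbK; apply: nex.
Qed.

Definition wt n (v : {ffun 'I_n -> option 'I_2}) (x : 'I_(2 ^ n)) : C :=
  \prod_j amp (v j) (qubit x j).

(** If x and y differ, they differ in some digit, and the factor of that pair vanishes. *)
Lemma phi_stateE n (v : {ffun 'I_n -> option 'I_2}) x y :
  phi_state R v (mxtens_index (x, y)) ord0 = (x == y)%:R * wt v x.
Proof.
rewrite mxE mxtens_indexK /=.
under eq_bigr do rewrite pair_stateE.
rewrite big_split /=; case: (eqVneq x y) => [->|nxy].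
  by congr (_ * _); apply: big1 => j _; rewrite eqxx.
by have [j hj] := qubit_neq nxy; rewrite (bigD1 j) //= (negPf hj) !mul0r.
Qed.

Lemma wt_ge0 n (v : {ffun 'I_n -> option 'I_2}) x : 0 <= wt v x.
Proof. by apply: prodr_ge0 => j _; apply: amp_ge0. Qed.

Lemma density_phiE n (v : {ffun 'I_n -> option 'I_2}) i j k l :
  density (phi_state R v) (mxtens_index (i, k)) (mxtens_index (j, l)) =
  (i == k)%:R * (j == l)%:R * (wt v i * wt v j).
Proof.
rewrite mxE big_ord1 adjmxE !phi_stateE rmorphM /= conjC_nat (geC0_conj (wt_ge0 _ _)).
by rewrite /= mulrACA.
Qed.

Lemma tensmap_phi n m p (v : {ffun 'I_n -> option 'I_2})
    (E : 'M[C]_(2 ^ n) -> 'M[C]_m) (F : 'M[C]_(2 ^ n) -> 'M[C]_p) :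
  tensmap E F (density (phi_state R v)) =
  \sum_x \sum_y (wt v x * wt v y) *: (E (delta_mx x y) *t F (delta_mx x y)).
Proof.
apply: eq_bigr => x _.
rewrite (bigD1 x) //= [X in _ + X]big1 ?addr0 => [|k nk]; last first.
  apply: big1 => j _; apply: big1 => l _.
  by rewrite density_phiE (eq_sym x) (negPf nk) !mul0r scale0r.
apply: eq_bigr => y _.
rewrite (bigD1 y) //= [X in _ + X]big1 ?addr0 => [|l nl].
  by rewrite density_phiE !eqxx !mul1r.
by rewrite density_phiE (eq_sym y) (negPf nl) mulr0 mul0r scale0r.
Qed.

(** * Bounding the fidelity block by block *)

Lemma norm_mul_le (x y : C) : `|x * y| <= 2^-1 * (`|x| ^+ 2 + `|y| ^+ 2).
Proof.
rewrite normrM -subr_ge0.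
have -> : 2^-1 * (`|x| ^+ 2 + `|y| ^+ 2) - `|x| * `|y| =
  2^-1 * (`|x| - `|y|) ^+ 2 by field.
by rewrite mulr_ge0 ?invr_ge0 ?ler0n // real_exprn_even_ge0 // realB ?normr_real.
Qed.

(** Bounds the modulus of the fidelity contribution of |x><y|; the 1/4 is 1/2 from [fidelity_tens]
    times 1/2 from [norm_mul_le]. The indicator vector enters only through the weights [wt], which
    are kept apart. *)
Definition overlap n (P : protocol0 R n) (x y : 'I_(2 ^ n)) : C :=
  \sum_w real_complex R (prob w) * (4^-1 *
    (\sum_a \sum_b `|alice (p := P) w (delta_mx x y) a b| ^+ 2 +
     \sum_a \sum_b `|bob (p := P) w (delta_mx x y) a b| ^+ 2)).

Lemma overlap_ge0 n (P : protocol0 R n) x y : 0 <= overlap P x y.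
Proof.
apply: sumr_ge0 => w _; rewrite mulr_ge0 ?ler0c ?prob_ge0 //.
rewrite mulr_ge0 ?invr_ge0 ?ler0n // addr_ge0 //;
  by apply: sumr_ge0 => a _; apply: sumr_ge0 => b _; apply: exprn_ge0.
Qed.

Lemma fidelity_le n (P : protocol0 R n) v :
  real_complex R (fidelity (run P (density (phi_state R v)))) <=
  \sum_x \sum_y wt v x * wt v y * overlap P x y.
Proof.
pose t w x y := (adjmx (Phi_plus R) *m
  (alice (p := P) w (delta_mx x y) *t bob (p := P) w (delta_mx x y)) *m
  Phi_plus R) ord0 ord0.
have tE : (adjmx (Phi_plus R) *m run P (density (phi_state R v)) *m Phi_plus R)
    ord0 ord0 =
    \sum_w real_complex R (prob w) * \sum_x \sum_y wt v x * wt v y * t w x y.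
  (* [Phi_plus] is itself a scaled vector; generalizing it keeps its scalar out of reach of
     [scalemxAr]. *)
  rewrite /t; move: (Phi_plus R) => Q.
  rewrite /run mulmx_sumr mulmx_suml summxE; apply: eq_bigr => w _.
  rewrite -scalemxAr -scalemxAl mxE; congr (_ * _).
  rewrite tensmap_phi mulmx_sumr mulmx_suml summxE; apply: eq_bigr => x _.
  rewrite mulmx_sumr mulmx_suml summxE; apply: eq_bigr => y _.
  by rewrite -scalemxAr -scalemxAl mxE.
rewrite /fidelity tE.
(* Passing from the real part to the modulus opens the way to the triangle inequality. *)
apply: le_trans (_ : _ <= real_complex R `|complex.Re _|) _.
  by rewrite lecR; apply: ler_norm.
apply: le_trans (normc_ge_Re _) _.
have -> : \sum_x \sum_y wt v x * wt v y * overlap P x y =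
    \sum_w real_complex R (prob w) * \sum_x \sum_y wt v x * wt v y * (4^-1 *
    (\sum_a \sum_b `|alice (p := P) w (delta_mx x y) a b| ^+ 2 +
     \sum_a \sum_b `|bob (p := P) w (delta_mx x y) a b| ^+ 2)).
  under [RHS]eq_bigr do rewrite mulr_sumr.
  rewrite [RHS]exchange_big; apply: eq_bigr => x _.
  under [RHS]eq_bigr do rewrite mulr_sumr.
  rewrite [RHS]exchange_big; apply: eq_bigr => y _.
  by rewrite mulr_sumr; apply: eq_bigr => w _; rewrite mulrCA.
apply: le_trans (ler_norm_sum _ _ _) _; apply: ler_sum => w _.
have p0 : 0 <= real_complex R (prob w) by rewrite ler0c prob_ge0.
rewrite normrM (ger0_norm p0) ler_wpM2l //.
apply: le_trans (ler_norm_sum _ _ _) _; apply: ler_sum => x _.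
apply: le_trans (ler_norm_sum _ _ _) _; apply: ler_sum => y _.
have w0 : 0 <= wt v x * wt v y by rewrite mulr_ge0 ?wt_ge0.
rewrite normrM (ger0_norm w0) ler_wpM2l // /t fidelity_tens normrM.
have -> : (4^-1 : C) = 2^-1 * 2^-1 by rewrite -invfM -natrM.
rewrite ger0_norm ?invr_ge0 ?ler0n // -mulrA ler_wpM2l ?invr_ge0 ?ler0n //.
rewrite -big_split mulr_sumr /=.
apply: le_trans (ler_norm_sum _ _ _) _; apply: ler_sum => a _.
rewrite -big_split mulr_sumr /=.
by apply: le_trans (ler_norm_sum _ _ _) _; apply: ler_sum => b _; apply: norm_mul_le.
Qed.

(** Alice and Bob contribute at most c each for every random string, and (c + c) / 4 = c / 2
    survives averaging. The family (f, g) serves both for all blocks and for the diagonal ones. *)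
Lemma sum_overlap_le n (P : protocol0 R n) (I : finType)
    (f g : I -> 'I_(2 ^ n)) (c : C) :
  (forall E : channel R (2 ^ n) 2,
    \sum_i \sum_a \sum_b `|E (delta_mx (f i) (g i)) a b| ^+ 2 <= c) ->
  \sum_i overlap P (f i) (g i) <= 2^-1 * c.
Proof.
move=> hc; rewrite /overlap exchange_big /=.
have -> : 2^-1 * c = \sum_w real_complex R (prob (p := P) w) * (4^-1 * (c + c)).
  rewrite -mulr_suml -rmorph_sum prob_sum1 rmorph1 mul1r.
  have -> : (4^-1 : C) = 2^-1 * 2^-1 by rewrite -invfM -natrM.
  by field.
apply: ler_sum => w _.
rewrite -mulr_sumr ler_wpM2l ?ler0c ?prob_ge0 //.
rewrite -mulr_sumr ler_wpM2l ?invr_ge0 ?ler0n //.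
by rewrite big_split; apply: lerD.
Qed.

Lemma sum_overlap n (P : protocol0 R n) :
  \sum_x \sum_y overlap P x y <= (2 ^ n)%:R.
Proof.
rewrite pair_big /= -[leRHS](mulKf (_ : 2 != 0)) ?pnatr_eq0 //.
apply: (@sum_overlap_le _ P _ fst snd) => E.
by rewrite -(pair_big xpredT xpredT (fun x y =>
  \sum_a \sum_b `|E (delta_mx x y) a b| ^+ 2)) sum_sqr_channel.
Qed.

Lemma sum_overlap_diag n (P : protocol0 R n) :
  \sum_x overlap P x x <= 2^-1 * (2 ^ n)%:R.
Proof.
apply: (@sum_overlap_le _ P _ id id) => E.
have -> : (2 ^ n)%:R = \sum_(x < 2 ^ n) 1 :> C by rewrite sumr_const card_ord.
by apply: ler_sum => x _; apply: sum_sqr_channel_diag.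
Qed.

(** * Averaging over the measured positions and the outcomes *)

Definition measured n (S : {set 'I_n}) (z : {ffun 'I_n -> 'I_2}) :
    {ffun 'I_n -> option 'I_2} :=
  [ffun j => if j \in S then Some (z j) else None].

Lemma degree_measured n (S : {set 'I_n}) z : degree (measured S z) = #|S|.
Proof.
by apply: eq_card => j; rewrite !inE ffunE; case: (j \in S).
Qed.

(** The sum factors over the positions. A position in S yields [x_j = y_j], which is the dephasing;
    one outside S yields 2 * (1/2) = 1, because z ranges over both values there as well. *)
Lemma sum_wt_measured n (S : {set 'I_n}) (x y : 'I_(2 ^ n)) :
  \sum_z wt (measured S z) x * wt (measured S z) y =
  [forall j in S, qubit x j == qubit y j]%:R.
Proof.
under eq_bigr => z _.
  rewrite /wt -big_split /=.
  under eq_bigr do rewrite ffunE.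
  over.
rewrite -(bigA_distr_bigA (fun j (c : 'I_2) =>
  amp (if j \in S then Some c else None) (qubit x j) *
  amp (if j \in S then Some c else None) (qubit y j))).
have val j : \sum_(c : 'I_2) amp (if j \in S then Some c else None) (qubit x j) *
    amp (if j \in S then Some c else None) (qubit y j) =
    ((j \in S) ==> (qubit x j == qubit y j))%:R :> C.
  case: (j \in S) => /=.
    rewrite (bigD1 (qubit x j)) //= eqxx mul1r big1 ?addr0 1?eq_sym // => c nc.
    by rewrite eq_sym (negPf nc) mul0r.
  by rewrite sqrtV2_sqr sumr_const card_ord -[_ *+ 2]mulr_natr mulVf ?pnatr_eq0.
under eq_bigr do rewrite val.
case: forallP => [hS | nS]; first by apply: big1 => j _; rewrite hS.
have /forallPn[j hj] : ~~ [forall j, (j \in S) ==> (qubit x j == qubit y j)].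
  by apply/forallP.
by rewrite (bigD1 j) //= (negPf hj) mul0r.
Qed.

(** For x != y the set S has to avoid a position where they differ, which leaves C(n-1, r) choices;
    for x = y every S counts. The truncated subtraction is exact because C(n-1, r) <= C(n, r). *)
Lemma sum_agree n r (x y : 'I_(2 ^ n)) :
  (\sum_(S : {set 'I_n} | #|S| == r) [forall j in S, qubit x j == qubit y j] <=
    'C(n.-1, r) + (x == y) * ('C(n, r) - 'C(n.-1, r)))%N.
Proof.
have C_le : ('C(n.-1, r) <= 'C(n, r))%N by apply: leq_bin2l; apply: leq_pred.
case: eqVneq => [_|nxy].
  rewrite mul1n subnKC // -[n in 'C(n, _)]card_ord -card_draws -sum1_card.
  rewrite [leqRHS](eq_bigl (fun S : {set 'I_n} => #|S| == r)) => [|S].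
    by apply: leq_sum => S _; apply: leq_b1.
  by rewrite inE.
have [j hj] := qubit_neq nxy.
rewrite mul0n addn0.
have -> : n.-1 = #|[set~ j]| by rewrite cardsC1 card_ord.
rewrite -cards_draws -sum1_card big_mkcond [leqRHS]big_mkcond /=.
apply: leq_sum => S _; rewrite inE andbC; case: (#|S| == r) => //=.
case: forallP => // hS; case: (boolP (_ \subset _)) => // /fintype.subsetP[] i iS.
by rewrite !inE; apply: contraNneq hj => <-; have := hS i; rewrite iS.
Qed.

Lemma sum_fidelity_le n r (P : protocol0 R n) : (0 < n)%N -> (r <= n)%N ->
  \sum_(S : {set 'I_n} | #|S| == r) \sum_z
    fidelity (run P (density (phi_state R (measured S z)))) <=
  'C(n, r)%:R * (2 ^ n)%:R * (1 - r%:R / (2 * n%:R)).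
Proof.
move=> n0 rn; rewrite -lecR rmorph_sum /=.
pose c : C := 'C(n, r)%:R; pose c' : C := 'C(n.-1, r)%:R.
have nC : n%:R != 0 :> C by rewrite pnatr_eq0 -lt0n.
(* From n C(n-1, r) = (n - r) C(n, r); the ratio is the chance that a random S misses a given
   position. *)
have c'E : c' = (1 - r%:R / n%:R) * c.
  apply: (mulfI nC); rewrite -natrM mul_bin_down natrM natrB // -/c.
  by field.
(* All blocks get weight c' and the diagonal ones c - c' more; the two overlap bounds then give 2^n
   (c' + (c - c') / 2), which is the right side. *)
apply: le_trans (_ : _ <= \sum_x \sum_y (c' + (x == y)%:R * (c - c')) *
  overlap P x y) _; last first.
  have -> : \sum_x \sum_y (c' + (x == y)%:R * (c - c')) * overlap P x y =
      c' * (\sum_x \sum_y overlap P x y) + (c - c') * \sum_x overlap P x x.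
    rewrite !mulr_sumr -big_split; apply: eq_bigr => x _ /=.
    rewrite mulr_sumr (bigD1 x) //= [in RHS](bigD1 x) //= eqxx mul1r mulrDl.
    rewrite addrAC; congr (_ + _ + _); apply: eq_bigr => y ny.
    by rewrite eq_sym (negPf ny) mul0r addr0.
  have cc : 0 <= c - c'.
    by rewrite subr_ge0 ler_nat; apply: leq_bin2l; apply: leq_pred.
  apply: le_trans (lerD (ler_wpM2l _ (sum_overlap P))
    (ler_wpM2l cc (sum_overlap_diag P))) _; first by rewrite ler0n.
  rewrite le_eqVlt; apply/orP; left; apply/eqP.
  rewrite !(rmorphM, rmorphB, rmorph1, fmorphV, rmorph_nat) /= -/c c'E.
  by field.
under eq_bigr do rewrite rmorph_sum.
apply: le_trans (_ : _ <= \sum_(S : {set 'I_n} | #|S| == r) \sum_z \sum_x \sum_y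
  wt (measured S z) x * wt (measured S z) y * overlap P x y) _.
  by apply: ler_sum => S _; apply: ler_sum => z _; apply: fidelity_le.
(* For fixed x and y, summing the weights over z and S leaves the count bounded by [sum_agree]. *)
under eq_bigr do rewrite exchange_big.
rewrite exchange_big; apply: ler_sum => x _ /=.
under eq_bigr do rewrite exchange_big.
rewrite exchange_big; apply: ler_sum => y _ /=.
under eq_bigr do rewrite -mulr_suml sum_wt_measured.
rewrite -mulr_suml ler_wpM2r ?overlap_ge0 //.
have C_le : ('C(n.-1, r) <= 'C(n, r))%N by apply: leq_bin2l; apply: leq_pred.
by rewrite -natr_sum -natrB // -natrM -natrD ler_nat sum_agree.
Qed.

End Fidelity.

(** * The worst case compared with the average *)

Theorem theorem1 (R : realType) (n r : nat) (hn : (1 <= n)%N) (hr : (r <= n)%N)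
    (P : protocol0 R n) :
  model_fidelity (measure_model R n r) P <= 1 - r%:R / (2 * n%:R).
Proof.
set b := 1 - _.
pose fid v := fidelity (run P (density (phi_state R v))).
have lb v : degree v = r -> model_fidelity (measure_model R n r) P <= fid v.
  move=> dv; apply: ge_inf; last first.
    by exists (density (phi_state R v)) => //; exists v.
  (* [ge_inf] needs a lower bound of the set; as there are finitely many vectors, minus the sum of
     all moduli is one. *)
  exists (- \sum_v' `|fid v'|) => _ [_ [v' _ <-] <-].
  rewrite lerNl (bigD1 v') //= ler_wpDr ?sumr_ge0 //.
  by rewrite -normrN ler_norm.
have c0 : 0 < 'C(n, r)%:R * (2 ^ n)%:R :> R.
  by rewrite -natrM ltr0n muln_gt0 bin_gt0 hr expn_gt0.
(* C(n, r) 2^n counts the pairs (S, z), so the claim becomes that the infimum, summed over all of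
   them, is at most the sum of their fidelities. *)
rewrite -(ler_pM2l c0); apply: le_trans (sum_fidelity_le P hn hr).
have -> : 'C(n, r)%:R * (2 ^ n)%:R * model_fidelity (measure_model R n r) P =
    \sum_(S : {set 'I_n} | #|S| == r) \sum_(z : {ffun 'I_n -> 'I_2})
      model_fidelity (measure_model R n r) P.
  rewrite !sumr_const card_ffun !card_ord -[in 'C(n, r)](card_ord n) -card_draws.
  rewrite -mulrA mulr_natl mulr_natl; congr (_ *+ _).
  by apply: eq_card => S; rewrite inE.
apply: ler_sum => S /eqP hS; apply: ler_sum => z _.
by apply: lb; rewrite degree_measured.
Qed.
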